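(* Let $B_\beta=\{B_\beta(t),t\ge0\}$ be a self-similar process with index $\beta>0$, let $c_+,c_->0$, $\alpha\in(-1,1)$, $x\in\mathbb R$, $\varepsilon>0$, $\delta,\gamma\in\mathbb R$. Let $X$ be a (weak) solution of $$X(t)=x+\int_0^t \bigl(c_+\mathbf 1_{X(s)\geq 0} -c_-\mathbf 1_{X(s)< 0}\bigr)|X(s)|^\alpha ds + \varepsilon B_\beta(t),\quad t\ge 0.\qquad (A)$$ Then the process $\widetilde X(t):=\varepsilon^\delta X(\varepsilon^{-\gamma}t)$ is a solution of $$\widetilde X(t)=x\varepsilon^\delta+ \varepsilon^{\delta(1-\alpha)-\gamma}\int_0^t \bigl(c_+\mathbf 1_{\widetilde X(s)\geq 0} -c_-\mathbf 1_{\widetilde X(s)< 0}\bigr)|\widetilde X(s)|^\alpha ds +\varepsilon^{1+\delta-\gamma\beta}\, \widetilde B_\beta(t),\quad t\geq 0,\qquad (B)$$ where $\widetilde B_\beta\overset{d}{=}B_\beta$. That is, writing $X_{x,c,\alpha,\varepsilon}$ for a weak solution of (A) with $c=(c_+,c_-)$, the distributions of the processes $$\{\varepsilon^\delta X_{x,c,\alpha,\varepsilon}(\varepsilon^{-\gamma}t),\ t\ge0\}\quad\text{and}\quad \{X_{x\varepsilon^\delta,\;c\,\varepsilon^{\delta(1-\alpha)-\gamma},\;\alpha,\;\varepsilon^{1+\delta-\gamma\beta}}(t),\ t\ge 0\}$$ are equal if at least one of the equations (A), (B) has a unique weak solution. In particular, if $x=0$, $\delta=\frac{1}{(1-\alpha)\beta-1}$,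 $\gamma=\frac{1-\alpha}{(1-\alpha)\beta-1}$ (with $(1-\alpha)\beta\ne1$), then $\widetilde X$ satisfies $$\widetilde X(t)=\int_0^t \bigl(c_+\mathbf 1_{\widetilde X (s)\geq 0} -c_-\mathbf 1_{\widetilde X (s)< 0}\bigr)|\widetilde X (s)|^\alpha ds + \widetilde B_\beta(t),\quad t\geq 0,$$ with $\widetilde B_\beta\overset{d}{=}B_\beta$.
   Context: A process $B_\beta$ is self-similar with index $\beta>0$ if for every $a>0$ the processes $\{B_\beta(at),t\ge0\}$ and $\{a^\beta B_\beta(t),t\ge0\}$ have the same distribution. All processes have càdlàg trajectories. A weak solution to such an equation is a pair of adapted processes $(\tilde X,\tilde B_\beta)$ on a filtered probability space such that the pair satisfies the equation a.s. and $\tilde B_\beta\overset{d}{=}B_\beta$ (if $B_\beta$ is a Lévy process, $\tilde B_\beta$ is required to be a Lévy process with respect to the filtration; if $B_\beta$ is a fractional Brownian motion, $\tilde B_\beta$ is required to be a fractional Brownian motion with respect to the filtration, i.e. the Brownian motion associated with it by the canonical Volterra kernel representation is a Brownian motion with respect to the filtration). Weak uniqueness means that all weak solutions have the same distribution. *)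

(* Defs.v *)
From HB Require Import structures.
From mathcomp Require Import all_boot all_order all_algebra.
From mathcomp Require Import all_classical all_reals all_analysis.

Set Implicit Arguments.
Unset Strict Implicit.
Unset Printing Implicit Defensive.

Import Order.TTheory GRing.Theory Num.Theory.
Import numFieldNormedType.Exports.

Local Open Scope classical_set_scope.
Local Open Scope ring_scope.

(* A real process {X(t), t >= 0} on T is a function X : R -> T -> R; its values
   at negative times are ignored by every definition of this file. *)

Section processes.
Context (R : realType).
Implicit Types (f : R -> R) (a b t : R).

Definition cadlag f : Prop :=
  (forall t, 0 <= t -> f s @[s --> t^'+] --> f t) /\
  (forall t, 0 < t -> cvg (f s @[s --> t^'-])).

Definition cadlag_process d (T : measurableType d) (X : R -> T -> R) : Prop :=
  (forall t, 0 <= t -> measurable_fun setT (X t)) /\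
  (forall w, cadlag (fun t => X t w)).

Definition path_cylinders : set (set (R -> R)) :=
  [set C | exists t (A : set R),
     [/\ 0 <= t, measurable A & C = [set f | A (f t)]]].

(* Equality of the laws on the path space with the sigma-algebra generated by
   the evaluations at times t >= 0. *)
Definition same_distribution d (T : measurableType d) (P : probability T R)
    (X : R -> T -> R) d' (T' : measurableType d') (P' : probability T' R)
    (X' : R -> T' -> R) : Prop :=
  forall A : set (R -> R), <<s path_cylinders >> A ->
    P [set w | A (fun t => X t w)] = P' [set w | A (fun t => X' t w)].

Definition self_similar d (T : measurableType d) (P : probability T R)
    (beta : R) (B : R -> T -> R) : Prop :=
  forall a, 0 < a ->
    same_distribution P (fun t w => B (a * t) w)
                      P (fun t w => a `^ beta * B t w).

Definition filtration d (T : measurableType d) (F : R -> set (set T)) : Prop :=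
  [/\ forall t, 0 <= t -> sigma_algebra setT (F t),
      forall t, 0 <= t -> F t `<=` measurable &
      forall s t, 0 <= s -> s <= t -> F s `<=` F t].

Definition adapted d (T : measurableType d) (F : R -> set (set T))
    (X : R -> T -> R) : Prop :=
  forall t, 0 <= t -> forall A : set R, measurable A -> F t (X t @^-1` A).

Definition natural_filtration d (T : measurableType d) (X : R -> T -> R)
    (t : R) : set (set T) :=
  <<s [set C | exists s (A : set R),
         [/\ 0 <= s <= t, measurable A & C = X s @^-1` A]] >>.

Definition independent_increments d (T : measurableType d)
    (P : probability T R) (F : R -> set (set T)) (B : R -> T -> R) : Prop :=
  forall s t, 0 <= s -> s <= t ->
  forall (A : set T) (C : set R), F s A -> measurable C ->
    P (A `&` [set w | C (B t w - B s w)]) =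
    (P A * P [set w | C (B t w - B s w)%R])%E.

(* B is a Levy process with respect to F. *)
Definition levy_wrt d (T : measurableType d) (P : probability T R)
    (F : R -> set (set T)) (B : R -> T -> R) : Prop :=
  [/\ cadlag_process B,
      adapted F B,
      {ae P, forall w, B 0 w = 0},
      independent_increments P F B &
      forall s t, 0 <= s -> s <= t -> forall C : set R, measurable C ->
        P [set w | C (B t w - B s w)] = P [set w | C (B (t - s) w)]].

Definition levy d (T : measurableType d) (P : probability T R)
    (B : R -> T -> R) : Prop :=
  levy_wrt P (natural_filtration B) B.

(* B is a Brownian motion with respect to F. The filtration is not assumed to
   be complete, hence continuity of the paths is only required a.s. *)
Definition brownian_wrt d (T : measurableType d) (P : probability T R)
    (F : R -> set (set T)) (W : R -> T -> R) : Prop :=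
  [/\ adapted F W,
      {ae P, forall w, W 0 w = 0},
      independent_increments P F W,
      (forall s t, 0 <= s -> s < t -> forall C : set R, measurable C ->
        P [set w | C (W t w - W s w)] = normal_prob 0 (Num.sqrt (t - s)) C) &
      {ae P, forall w, {within `[0, +oo[, continuous (fun t => W t w)}}].

Definition gaussian_rv d (T : measurableType d) (P : probability T R)
    (Y : T -> R) : Prop :=
  exists m s : R, 0 <= s /\ forall C : set R, measurable C ->
    P (Y @^-1` C) = if s == 0 then \d_m C else normal_prob m s C.

(* Fractional Brownian motion with Hurst index H. *)
Definition fbm d (T : measurableType d) (P : probability T R) (H : R)
    (B : R -> T -> R) : Prop :=
  [/\ 0 < H < 1,
      cadlag_process B,
      forall n (t a : 'I_n -> R), (forall i, 0 <= t i) ->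
        gaussian_rv P (fun w => \sum_(i < n) a i * B (t i) w),
      forall t, 0 <= t -> expectation P (B t) = 0%E &
      forall s t, 0 <= s -> 0 <= t ->
        covariance P (B s) (B t) =
          (2^-1 * (s `^ (2 * H) + t `^ (2 * H) - `|t - s| `^ (2 * H)))%:E].

(* A list of triples (c, (u, v)) stands for the step function
   \sum c * 1_{]u, v]}. *)
Definition step_fun (q : seq (R * (R * R))) (s : R) : R :=
  \sum_(p <- q) p.1 * (p.2.1 < s <= p.2.2)%R%:R.

Definition step_integral (T : Type) (W : R -> T -> R)
    (q : seq (R * (R * R))) (w : T) : R :=
  \sum_(p <- q) p.1 * (W p.2.2 w - W p.2.1 w).

(* Y is the Wiener integral \int_0^oo f(s) dW(s), i.e. the limit in L^2(P) of
   integrals of step functions converging to f in L^2([0, +oo[). *)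
Definition wiener_integral d (T : measurableType d) (P : probability T R)
    (W : R -> T -> R) (f : R -> R) (Y : T -> R) : Prop :=
  exists q : nat -> seq (R * (R * R)),
  [/\ forall n, all (fun p => (0 <= p.2.1 <= p.2.2)%R) (q n),
      (\int[lebesgue_measure]_(s in `[0%R, +oo[)
         ((step_fun (q n) s - f s) ^+ 2)%:E)%E @[n --> \oo] --> 0%E &
      (\int[P]_w ((step_integral W (q n) w - Y w) ^+ 2)%:E)%E
         @[n --> \oo] --> 0%E].

Definition Gamma (z : R) : R :=
  \int[lebesgue_measure]_(u in `]0, +oo[) (u `^ (z - 1) * expR (- u)).

(* The canonical Volterra (Molchan-Golosov) kernel of fractional Brownian
   motion, in the form valid for every H in ]0, 1[; it is 1_{]0, t[} for
   H = 1/2. *)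
Definition volterra_const (H : R) : R :=
  Num.sqrt (2 * H * Gamma (3 / 2 - H) / (Gamma (H + 1 / 2) * Gamma (2 - 2 * H))).

Definition volterra_kernel (H t s : R) : R :=
  if 0 < s < t then
    volterra_const H *
    ((t / s) `^ (H - 1 / 2) * (t - s) `^ (H - 1 / 2)
     - (H - 1 / 2) * s `^ (1 / 2 - H) *
       \int[lebesgue_measure]_(u in `]s, t[)
          (u `^ (H - 3 / 2) * (u - s) `^ (H - 1 / 2)))
  else 0.

(* B is an F-fractional Brownian motion: the process W such that
   B(t) = \int_0^t K_H(t, s) dW(s), which is a.s. determined by B, is an
   F-Brownian motion. *)
Definition fbm_wrt d (T : measurableType d) (P : probability T R)
    (F : R -> set (set T)) (H : R) (B : R -> T -> R) : Prop :=
  [/\ fbm P H B, adapted F B &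
      exists W : R -> T -> R, brownian_wrt P F W /\
        forall t, 0 <= t -> wiener_integral P W (volterra_kernel H t) (B t)].

(* |y|^alpha, equal to +oo when y = 0 and alpha < 0, whereas powR is then 0. *)
Definition abs_pow (alpha y : R) : \bar R :=
  if (y == 0) && (alpha < 0) then +oo%E else (`|y| `^ alpha)%:E.

Definition drift (cp cm alpha y : R) : \bar R :=
  ((cp * (0 <= y)%R%:R - cm * (y < 0)%R%:R)%:E * abs_pow alpha y)%E.

Definition drift_integrable (cp cm alpha : R) (f : R -> R) (t : R) : Prop :=
  lebesgue_measure.-integrable `[0, t] (fun s => drift cp cm alpha (f s)).

Definition drift_integral (cp cm alpha : R) (f : R -> R) (t : R) : R :=
  fine (\int[lebesgue_measure]_(s in `[0%R, t]) drift cp cm alpha (f s))%E.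

(* f is the path of the solution and b the path of the noise. *)
Definition sde (x cp cm alpha eps : R) (f b : R -> R) : Prop :=
  forall t, 0 <= t -> drift_integrable cp cm alpha f t /\
    f t = x + drift_integral cp cm alpha f t + eps * b t.

Definition scaled_sde (x k cp cm alpha eps : R) (f b : R -> R) : Prop :=
  forall t, 0 <= t -> drift_integrable cp cm alpha f t /\
    f t = x + k * drift_integral cp cm alpha f t + eps * b t.

(* On the space (T, F, P), the pair (X, B) is a weak solution of the equation E
   driven by the process B0 (given on (T0, P0)). *)
Definition weak_solution d0 (T0 : measurableType d0) (P0 : probability T0 R)
    (B0 : R -> T0 -> R) (E : (R -> R) -> (R -> R) -> Prop)
    d (T : measurableType d) (P : probability T R)
    (F : R -> set (set T)) (X B : R -> T -> R) : Prop :=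
  [/\ filtration F /\ (cadlag_process X /\ cadlag_process B),
      adapted F X /\ adapted F B,
      {ae P, forall w, E (fun t => X t w) (fun t => B t w)},
      same_distribution P B P0 B0 &
      (levy P0 B0 -> levy_wrt P F B) /\
      (forall H, fbm P0 H B0 -> fbm_wrt P F H B)].

Definition weak_uniqueness d0 (T0 : measurableType d0) (P0 : probability T0 R)
    (B0 : R -> T0 -> R) (E : (R -> R) -> (R -> R) -> Prop) : Prop :=
  forall d (T : measurableType d) (P : probability T R)
    (F : R -> set (set T)) (X B : R -> T -> R)
    d' (T' : measurableType d') (P' : probability T' R)
    (F' : R -> set (set T')) (X' B' : R -> T' -> R),
  weak_solution P0 B0 E P F X B -> weak_solution P0 B0 E P' F' X' B' ->
  same_distribution P X P' X'.

Definition rescale (T : Type) (eps delta gamma : R) (X : R -> T -> R)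
    (t : R) (w : T) : R :=
  eps `^ delta * X (eps `^ (- gamma) * t) w.

End processes.

(* Main.v *)
Require Import Defs.
From HB Require Import structures.
From mathcomp Require Import all_boot all_order all_algebra.
From mathcomp Require Import all_classical all_reals all_analysis.
From mathcomp Require Import measurable_realfun ring lra.
Import Order.TTheory GRing.Theory Num.Theory.
Import numFieldNormedType.Exports.
Local Open Scope classical_set_scope.
Local Open Scope ring_scope.

Set Implicit Arguments.
Unset Strict Implicit.

(** Write r = eps^delta and a = eps^(-gamma), so that the rescaled process is
    t |-> r X(a t).  Two homogeneities make it a solution of (B): the drift
    y |-> (c_+ 1_{y >= 0} - c_- 1_{y < 0}) |y|^alpha is positively homogeneous
    of degree alpha, so that the substitution s = a u multiplies the drift
    integral by r^(1 - alpha) a ([scaled_sde_dilate]); and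
    t |-> a^(-beta) B(a t) is again a copy of B by self-similarity
    ([self_similar_dilate]), so that r B(a t) is r a^beta times a copy of B.

    A weak solution also carries a filtration, and the new noise has to stand
    in the right relation to the new filtration t |-> F(a t).  The Levy
    property only involves increments and passes through a dilation of time.
    For a fractional Brownian motion one has to exhibit the Brownian motion
    behind the new noise: it is W'(t) = a^(-1/2) W(a t).  This works because
    the Volterra kernel satisfies K_H(a t, a s) = a^(H - 1/2) K_H(t, s)
    ([volterra_kernel_homogeneous]), which turns the representation of B by W
    into a representation of a^(-H) B(a t) by W' ([wiener_integral_dilate]).
    The exponents match since a beta-self-similar fractional Brownian motion of
    Hurst index H has H = beta: compare the variances at times 1 and 2
    ([self_similar_fbm_index]).

    All this is collected in [weak_solution_dilate], for arbitrary positive r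
    and a.  Taking 1/r and 1/a sends solutions of (B) back to solutions of (A),
    so that uniqueness in law for either equation identifies the law of the
    rescaled X with that of any solution of (B). *)

(** * Integrals of arbitrary nonnegative functions *)

Section unmeasurable_integrands.
Context d (T : measurableType d) (R : realType).
Variable mu : {measure set T -> \bar R}.
Import HBNNSimple.
Local Open Scope ereal_scope.

(** The integral of a nonnegative function is by definition the supremum of the
    integrals of the simple functions below it.  Arguing on these simple
    functions gives the scaling rules below for every function, which matters
    for the Volterra kernel: measurability of its partial map s |-> K_H(t, s)
    would be a separate theorem. *)
Lemma ge0_integral_le_nnsfun (f : T -> \bar R) (M : \bar R) :
  (forall x, 0 <= f x) ->
  (forall h : {nnsfun T >-> R}, (forall x, (h x)%:E <= f x) ->
     \int[mu]_x (h x)%:E <= M) ->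
  \int[mu]_x f x <= M.
Proof.
move=> f0 hM; rewrite ge0_integralTE//; apply: ge_ereal_sup => _ [h hf <-].
by have := hM h hf; rewrite integral_nnsfun// patch_setT.
Qed.

Lemma ge0_le_integral_unmeasurable (f g : T -> \bar R) :
  (forall x, 0 <= f x) -> (forall x, f x <= g x) ->
  \int[mu]_x f x <= \int[mu]_x g x.
Proof.
move=> f0 fg; apply: ge0_integral_le_nnsfun => // h hf.
have g0 x : 0 <= g x by exact: le_trans (f0 x) (fg x).
rewrite integral_nnsfun// patch_setT ge0_integralTE//.
by apply: ereal_sup_ubound; exists h => // x; exact: le_trans (hf x) (fg x).
Qed.

Let ge0_le_integralZl (c : R) (f : T -> \bar R) : (0 < c)%R ->
  (forall x, 0 <= f x) -> \int[mu]_x (c%:E * f x) <= c%:E * \int[mu]_x f x.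
Proof.
move=> c0 f0; apply: ge0_integral_le_nnsfun => [x|h hf].
  by rewrite mule_ge0// lee_fin ltW.
rewrite -lee_pdivrMl//.
have mh : measurable_fun setT (fun x => (h x)%:E).
  exact/measurable_EFinP/measurable_funP.
rewrite -(ge0_integralZl _ _ mh)//; last 2 first.
- by move=> x _; rewrite lee_fin.
- by rewrite lee_fin invr_ge0 ltW.
apply: ge0_le_integral_unmeasurable => x.
  by rewrite -EFinM lee_fin mulr_ge0// invr_ge0 ltW.
by rewrite lee_pdivrMl.
Qed.

(** Divide by c the simple functions below c f; the reverse inequality is the
    same one for the function c f and the factor 1/c. *)
Lemma ge0_integralZl_unmeasurable (c : R) (f : T -> \bar R) : (0 < c)%R ->
  (forall x, 0 <= f x) -> \int[mu]_x (c%:E * f x) = c%:E * \int[mu]_x f x.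
Proof.
move=> c0 f0; apply/eqP; rewrite eq_le ge0_le_integralZl//=.
rewrite -lee_pdivlMl//.
have c'0 : (0 < c^-1)%R by rewrite invr_gt0.
apply: le_trans (ge0_le_integralZl c'0 _); last first.
  by move=> x; rewrite mule_ge0// lee_fin ltW.
under [leRHS]eq_integral do rewrite muleA -EFinM mulVf ?gt_eqF// mul1e.
exact: lexx.
Qed.

End unmeasurable_integrands.

(** This holds even in the indeterminate cases x = y = +oo and x = y = -oo,
    where both sides take the same conventional value; hence the scaling rules extend to
    integrals of signed functions that are not integrable. *)
Lemma gt0_muleBr (R : realType) (c : R) (x y : \bar R) : 0 < c ->
  (c%:E * (x - y) = c%:E * x - c%:E * y)%E.
Proof.
move=> c0; case: x y => [x| |] [y| |] /=;
  rewrite ?(gt0_muley, gt0_muleNy) ?lte_fin//=.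
  by rewrite -EFinB -!EFinM mulrBr.
all: by rewrite ?(gt0_muley, gt0_muleNy) ?lte_fin//=.
Qed.

Lemma gt0_integralZl d (T : measurableType d) (R : realType)
    (mu : {measure set T -> \bar R}) (D : set T) (c : R) (f : T -> \bar R) :
  0 < c -> (\int[mu]_(x in D) (c%:E * f x) = c%:E * \int[mu]_(x in D) f x)%E.
Proof.
move=> c0; rewrite integralE [in RHS]integralE gt0_muleBr//.
rewrite !(integral_mkcond D) -!ge0_integralZl_unmeasurable//; last 2 first.
- by move=> x; apply: erestrict_ge0 => y _; exact: funeneg_ge0.
- by move=> x; apply: erestrict_ge0 => y _; exact: funepos_ge0.
congr (_ - _)%E; apply: eq_integral => x _; rewrite /patch; case: ifP => _;
  rewrite ?mule0//=.
- by rewrite ge0_funeposM// ltW.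
- by rewrite ge0_funenegM// ltW.
Qed.

(** * Dilations of the integration variable *)

Section dilation.
Context (R : realType).
Import HBNNSimple.
Local Notation leb := (@lebesgue_measure R).

Let measurable_dilation (a : R) :
  measurable_fun setT ( *%R a : measurableTypeR R -> measurableTypeR R).
Proof. exact: mulrl_measurable. Qed.

(** Lebesgue measure again, since both measures agree on half-open intervals.
    The measure structure of a pushforward depends on a proof of measurability,
    which is supplied here by naming the structure. *)
Let dilated_leb (a : R) (a0 : 0 <= a) :
  {measure set (measurableTypeR R) -> \bar R} :=
  mscale (NngNum a0)
   (measure_function_pushforward__canonical__measure_function_Measure
      leb (measurable_dilation a)).

Lemma lebesgue_measure_dilation (a : R) (A : set R) : 0 < a -> measurable A ->
  leb A = (a%:E * leb ( *%R a @^-1` A))%E.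
Proof.
move=> a0 mA.
have /(_ _ A mA) := @lebesgue_measure_unique R (dilated_leb (ltW a0)).
apply=> X /ocitvP[->|[[u v]/= uv ->]]; first by rewrite !measure0.
rewrite /dilated_leb/= /mscale/= /pushforward.
rewrite (_ : _ @^-1` _ = `]a^-1 * u, a^-1 * v]%classic); last first.
  apply/seteqP; split => x /=; rewrite !in_itv/=.
    by rewrite ltr_pdivrMl// ler_pdivlMl.
  by rewrite ltr_pdivrMl// ler_pdivlMl.
rewrite !lebesgue_measure_itv/= !lte_fin uv ltr_pM2l ?invr_gt0// uv.
by rewrite -!EFinB -EFinM -mulrBr mulVKf// gt_eqF.
Qed.

Let measurable_ge0_integral_dilation (a : R) (f : R -> \bar R) : 0 < a ->
  measurable_fun setT f -> (forall x, 0 <= f x)%E ->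
  (\int[leb]_x f (a * x)%R = a^-1%:E * \int[leb]_x f x)%E.
Proof.
move=> a0 mf f0.
have -> : (\int[leb]_x f x)%E = (\int[dilated_leb (ltW a0)]_x f x)%E.
  by apply: eq_measure_integral => A mA _; exact: lebesgue_measure_dilation.
rewrite ge0_integral_mscale//= muleA -EFinM mulVf ?gt_eqF// mul1e.
by rewrite (ge0_integral_pushforward (measurable_dilation a)).
Qed.

(** If a simple function h is below x |-> f (a x), then y |-> h (y / a) is a
    measurable function below f. *)
Let ge0_le_integral_dilation (a : R) (f : R -> \bar R) : 0 < a ->
  (forall x, 0 <= f x)%E ->
  (\int[leb]_x f (a * x)%R <= a^-1%:E * \int[leb]_x f x)%E.
Proof.
move=> a0 f0; apply: ge0_integral_le_nnsfun => // h hf.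
rewrite (_ : (\int[leb]_x (h x)%:E)%E =
             (\int[leb]_x (h (a^-1 * (a * x)))%:E)%E); last first.
  by apply: eq_integral => x _; rewrite mulKf// gt_eqF.
rewrite (@measurable_ge0_integral_dilation _ (fun x => (h (a^-1 * x))%:E))//.
- rewrite lee_pmul2l ?lte_fin ?invr_gt0//.
  apply: ge0_le_integral_unmeasurable => x; first by rewrite lee_fin.
  by rewrite (le_trans (hf _))// mulVKf// gt_eqF.
- have mh : measurable_fun setT (h : measurableTypeR R -> R).
    exact: measurable_funP.
  by apply/measurable_EFinP; exact: measurableT_comp mh (measurable_dilation _).
- by move=> x; rewrite lee_fin.
Qed.

Let ge0_integral_dilation (a : R) (f : R -> \bar R) : 0 < a ->
  (forall x, 0 <= f x)%E ->
  (\int[leb]_x f (a * x)%R = a^-1%:E * \int[leb]_x f x)%E.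
Proof.
move=> a0 f0; apply/eqP; rewrite eq_le ge0_le_integral_dilation//=.
rewrite lee_pdivrMl//.
have a'0 : (0 < a^-1)%R by rewrite invr_gt0.
have := ge0_le_integral_dilation (f := fun x => f (a * x)) a'0
  (fun x => f0 _).
rewrite invrK; apply: le_trans.
under [leRHS]eq_integral do rewrite mulVKf ?gt_eqF//.
exact: lexx.
Qed.

Lemma integral_dilation (a : R) (D : set R) (f : R -> \bar R) : 0 < a ->
  (\int[leb]_(x in [set x | D (a * x)%R]) f (a * x)%R =
   a^-1%:E * \int[leb]_(x in D) f x)%E.
Proof.
move=> a0; rewrite integralE [in RHS]integralE gt0_muleBr ?invr_gt0//.
rewrite !(@integral_mkcond _ _ _ leb D) -!ge0_integral_dilation//; last 2 first.
- by move=> x; apply: erestrict_ge0 => y _; exact: funeneg_ge0.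
- by move=> x; apply: erestrict_ge0 => y _; exact: funepos_ge0.
have inD x : (x \in [set x | D (a * x)]) = (a * x \in D).
  by apply/idP/idP => /set_mem ?; apply/mem_set.
by congr (_ - _)%E; rewrite integral_mkcond; apply: eq_integral => x _;
  rewrite /patch inD ?funeposE ?funenegE.
Qed.

End dilation.

Lemma fine_gt0Zl {R : realType} (c : R) (x : \bar R) : 0 < c ->
  fine (c%:E * x)%E = c * fine x.
Proof.
move=> c0; case: x => [r| |]; first by [].
  by rewrite gt0_muley ?lte_fin//= mulr0.
by rewrite gt0_muleNy ?lte_fin//= mulr0.
Qed.

Lemma gt0_RintegralZl {R : realType} d (T : measurableType d)
    (mu : {measure set T -> \bar R}) (D : set T) (c : R) (f : T -> R) : 0 < c ->
  \int[mu]_(x in D) (c * f x) = c * \int[mu]_(x in D) f x.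
Proof.
by move=> c0; rewrite /Rintegral -fine_gt0Zl// -gt0_integralZl.
Qed.

Lemma Rintegral_dilation {R : realType} (a : R) (D : set R) (f : R -> R) :
  0 < a ->
  \int[lebesgue_measure]_(x in D) f x =
  a * \int[lebesgue_measure]_(x in [set x | D (a * x)]) f (a * x).
Proof.
move=> a0; rewrite /Rintegral (@integral_dilation _ a D (EFin \o f))//.
by rewrite fine_gt0Zl ?invr_gt0// mulVKf// gt_eqF.
Qed.

(** The bounds are given by case analysis so that this computes on concrete
    intervals, bounded or not. *)
Lemma set_itv_dilation {R : realType} (a : R) (i : interval R) : 0 < a ->
  [set x | [set` i] (a * x)] =
  [set` Interval (match i.1 with BSide b x => BSide b (a^-1 * x)
                             | BInfty b => BInfty _ b end)
                 (match i.2 with BSide b x => BSide b (a^-1 * x)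
                             | BInfty b => BInfty _ b end)].
Proof.
move=> a0; case: i => [[[] l|[]] [[] u|[]]]; apply/seteqP; split=> x /=;
  by rewrite !in_itv/= ?ltr_pdivlMl ?ltr_pdivrMl ?ler_pdivlMl ?ler_pdivrMl.
Qed.

(** * Dilated processes *)

Definition dilate {R : realType} {T : Type} (c a : R) (X : R -> T -> R)
  (t : R) (w : T) : R := c * X (a * t) w.

Lemma cadlag_dilate {R : realType} (c a : R) (f : R -> R) : 0 < a ->
  cadlag f -> cadlag (fun t => c * f (a * t)).
Proof.
move=> a0 [fr fl].
have mulr t : a * s @[s --> t^'+] --> (a * t)^'+.
  move=> A [e /= e0 eA]; exists (a^-1 * e); rewrite /= ?mulr_gt0 ?invr_gt0//.
  move=> s /= ts st; apply: eA; last by rewrite ltr_pM2l.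
  by rewrite /= -mulrBr normrM gtr0_norm// -ltr_pdivlMl.
have mull t : a * s @[s --> t^'-] --> (a * t)^'-.
  move=> A [e /= e0 eA]; exists (a^-1 * e); rewrite /= ?mulr_gt0 ?invr_gt0//.
  move=> s /= ts st; apply: eA; last by rewrite ltr_pM2l.
  by rewrite /= -mulrBr normrM gtr0_norm// -ltr_pdivlMl.
split=> t t0.
  apply: cvgMr; apply: (cvg_comp _ _ (mulr t)).
  by apply: fr; rewrite mulr_ge0// ltW.
apply: is_cvgMr; apply: cvgP; apply: (cvg_comp _ _ (mull t)).
exact: fl (a * t) (mulr_gt0 a0 t0).
Qed.

Lemma cadlag_process_dilate {R : realType} d (T : measurableType d)
    (c a : R) (X : R -> T -> R) : 0 < a ->
  cadlag_process X -> cadlag_process (dilate c a X).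
Proof.
move=> a0 [mX cX]; split=> [t t0|w].
  have at0 : 0 <= a * t by rewrite mulr_ge0// ltW.
  exact: measurable_funM (measurable_cst c) (mX _ at0).
exact: (@cadlag_dilate _ c a (X ^~ w) a0 (cX w)).
Qed.

Lemma filtration_dilate {R : realType} d (T : measurableType d)
    (a : R) (F : R -> set (set T)) : 0 < a ->
  filtration F -> filtration (fun t => F (a * t)).
Proof.
move=> a0 [sF mF nF]; split=> [t t0|t t0|s t s0 st].
- by apply: sF; rewrite mulr_ge0// ltW.
- by apply: mF; rewrite mulr_ge0// ltW.
- by apply: nF; rewrite ?mulr_ge0 ?ler_pM2l// ltW.
Qed.

Lemma measurable_preimage_mul {R : realType} (c : R) (A : set R) :
  measurable A -> measurable [set y | A (c * y)].
Proof.
move=> mA; have := @mulrl_measurable R setT c measurableT _ mA.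
by rewrite setTI.
Qed.

Lemma adapted_dilate {R : realType} d (T : measurableType d)
    (c a : R) (F : R -> set (set T)) (X : R -> T -> R) : 0 < a ->
  adapted F X -> adapted (fun t => F (a * t)) (dilate c a X).
Proof.
move=> a0 FX t t0 A mA.
apply: (FX (a * t) _ _ (measurable_preimage_mul c mA)).
by rewrite mulr_ge0// ltW.
Qed.

(** The map f |-> c f(a .) on paths is measurable, as it pulls cylinders back to
    cylinders. *)
Lemma path_cylinders_dilate {R : realType} (c a : R) (A : set (R -> R)) :
  0 <= a -> <<s @path_cylinders R >> A ->
  <<s @path_cylinders R >> [set f | A (fun t => c * f (a * t))].
Proof.
move=> a0.
pose G := [set A | <<s @path_cylinders R >>
                     [set f | A (fun t => c * f (a * t))]].
suff : <<s @path_cylinders R >> `<=` G by apply.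
have [s0 sC sU] := smallest_sigma_algebra setT (@path_cylinders R).
apply: smallest_sub.
  split=> [|B GB|B GB]; first exact: s0.
    by have := sC _ GB; rewrite !setTD.
  exact: (sU (fun n => [set f | B n (fun t => c * f (a * t))])).
move=> _ [t [B [t0 mB ->]]]; apply: sub_sigma_algebra.
exists (a * t), [set y | B (c * y)]; split=> //; first exact: mulr_ge0.
exact: measurable_preimage_mul.
Qed.

Section same_distribution_theory.
Context {R : realType} d1 (T1 : measurableType d1) (P1 : probability T1 R)
  d2 (T2 : measurableType d2) (P2 : probability T2 R)
  d3 (T3 : measurableType d3) (P3 : probability T3 R).
Variables (X1 : R -> T1 -> R) (X2 : R -> T2 -> R) (X3 : R -> T3 -> R).

Lemma same_distribution_trans : same_distribution P1 X1 P2 X2 ->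
  same_distribution P2 X2 P3 X3 -> same_distribution P1 X1 P3 X3.
Proof. by move=> h12 h23 A sA; rewrite h12// h23. Qed.

Lemma same_distribution_dilate (c a : R) : 0 <= a ->
  same_distribution P1 X1 P2 X2 ->
  same_distribution P1 (dilate c a X1) P2 (dilate c a X2).
Proof.
by move=> a0 h A sA; exact: (h _ (path_cylinders_dilate c a0 sA)).
Qed.

End same_distribution_theory.

Lemma dilateK {R : realType} {T : Type} (c a : R) (X : R -> T -> R) :
  c != 0 -> a != 0 -> dilate c a (dilate c^-1 a^-1 X) = X.
Proof.
by move=> c0 a0; apply/funext => t; apply/funext => w;
  rewrite /dilate mulVKf// mulKf.
Qed.

(** Self-similarity says that B(a .) and a^beta B have the same law; multiply
    both by a^(-beta). *)
Lemma self_similar_dilate {R : realType} d (T : measurableType d)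
    (P : probability T R) (beta a : R) (B : R -> T -> R) : 0 < a ->
  self_similar P beta B -> same_distribution P (dilate (a `^ (- beta)) a B) P B.
Proof.
move=> a0 /(_ a a0) /(same_distribution_dilate (a `^ (- beta)) ler01).
have e0 : a `^ beta != 0 by rewrite gt_eqF// powR_gt0.
rewrite (_ : dilate _ 1 _ = dilate (a `^ (- beta)) a B); last first.
  by apply/funext => t; rewrite /dilate mul1r.
rewrite (_ : dilate _ 1 _ = B)//.
by apply/funext => t; apply/funext => w; rewrite /dilate mul1r powRN mulKf.
Qed.

Lemma dilate_increment {R : realType} {T : Type} (c a : R) (B : R -> T -> R)
    (s t : R) (C : set R) :
  [set w | C (dilate c a B t w - dilate c a B s w)] =
  [set w | C (c * (B (a * t) w - B (a * s) w))].
Proof. by apply/seteqP; split=> w /=; rewrite /dilate mulrBr. Qed.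

Lemma independent_increments_dilate {R : realType} d (T : measurableType d)
    (P : probability T R) (c a : R) (F : R -> set (set T)) (B : R -> T -> R) :
  0 < a -> independent_increments P F B ->
  independent_increments P (fun t => F (a * t)) (dilate c a B).
Proof.
move=> a0 iB s t s0 st A C FA mC.
have := iB (a * s) (a * t) _ _ A _ FA (measurable_preimage_mul c mC).
rewrite mulr_ge0 ?ler_pM2l//; last exact: ltW.
by move/(_ isT st); rewrite dilate_increment.
Qed.

Lemma levy_wrt_dilate {R : realType} d (T : measurableType d)
    (P : probability T R) (c a : R) (F : R -> set (set T)) (B : R -> T -> R) :
  0 < a -> levy_wrt P F B -> levy_wrt P (fun t => F (a * t)) (dilate c a B).
Proof.
move=> a0 [cB aB B0 iB sB]; split.
- exact: cadlag_process_dilate.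
- exact: adapted_dilate.
- by apply: filterS B0 => w B0; rewrite /dilate mulr0 B0 mulr0.
- exact: independent_increments_dilate.
- move=> s t s0 st C mC.
  have := sB (a * s) (a * t) _ _ _ (measurable_preimage_mul c mC).
  rewrite mulr_ge0 ?ler_pM2l//; last exact: ltW.
  by move/(_ isT st); rewrite -mulrBr dilate_increment.
Qed.

(** * Brownian motion, the Volterra kernel and Wiener integrals *)

Lemma normal_prob_dilation {R : realType} (c s : R) (C : set R) :
  0 < c -> s != 0 ->
  normal_prob 0 s [set y | C (c * y)] = normal_prob 0 (c * s) C.
Proof.
move=> c0 s0; rewrite /normal_prob.
have -> : (\int[lebesgue_measure]_(x in C) (normal_pdf 0 (c * s)%R x)%:E =
    c%:E * \int[lebesgue_measure]_(x in [set x | C (c * x)%R])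
      (normal_pdf 0 (c * s)%R (c * x)%R)%:E)%E.
  rewrite (@integral_dilation _ c C (fun x => (normal_pdf 0 (c * s) x)%:E))//.
  by rewrite muleA -EFinM divff ?mul1e// gt_eqF.
rewrite -gt0_integralZl//; apply: eq_integral => x _; rewrite -EFinM.
have cs0 : c * s != 0 by rewrite mulf_neq0// gt_eqF.
have sqrt_cs : Num.sqrt ((c * s) ^+ 2 * pi *+ 2) =
    c * Num.sqrt (s ^+ 2 * pi *+ 2).
  rewrite exprMn -mulrA -mulrnAr sqrtrM ?sqr_ge0//.
  by rewrite sqrtr_sqr gtr0_norm.
rewrite !normal_pdfE// /normal_peak /normal_fun !subr0 sqrt_cs invfM mulrA.
rewrite mulVKf ?gt_eqF//; congr (_ * expR _)%:E.
by field; rewrite s0 gt_eqF.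
Qed.

Lemma within_continuous_dilate {R : realType} (c a : R) (f : R -> R) : 0 < a ->
  {within `[0, +oo[, continuous f} ->
  {within `[0, +oo[, continuous (fun t => c * f (a * t))}.
Proof.
move=> a0 /subspace_continuousP cf; apply/subspace_continuousP => t.
rewrite /= in_itv/= andbT => t0; apply: cvgMr.
have at0 : 0 <= a * t by rewrite mulr_ge0// ltW.
have /cf : [set` `[0, +oo[%R] (a * t) by rewrite /= in_itv/= andbT.
apply: cvg_comp => A nA.
have : \forall s \near t, [set` `[0, +oo[%R] (a * s) -> A (a * s).
  have /(_ _ nA) : a * s @[s --> t] --> a * t by apply: cvgMr; exact: cvg_id.
  exact.
apply: filterS => s As; rewrite /= in_itv/= andbT => s0; apply: As.
by rewrite /= in_itv/= andbT mulr_ge0// ltW.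
Qed.

(** The increment of W over [a s, a t] has variance a (t - s), whence the factor
    a^(-1/2). *)
Lemma brownian_wrt_dilate {R : realType} d (T : measurableType d)
    (P : probability T R) (a : R) (F : R -> set (set T)) (W : R -> T -> R) :
  0 < a -> brownian_wrt P F W ->
  brownian_wrt P (fun t => F (a * t)) (dilate (Num.sqrt a)^-1 a W).
Proof.
move=> a0 [aW W0 iW nW cW]; split.
- exact: adapted_dilate.
- by apply: filterS W0 => w W0; rewrite /dilate mulr0 W0 mulr0.
- exact: independent_increments_dilate.
- move=> s t s0 st C mC; rewrite dilate_increment.
  have as0 : 0 <= a * s by rewrite mulr_ge0// ltW.
  have ast : a * s < a * t by rewrite ltr_pM2l.
  rewrite (nW _ _ as0 ast _ (measurable_preimage_mul _ mC)).
  rewrite (@normal_prob_dilation _ (Num.sqrt a)^-1 _ C).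
  - by rewrite -mulrBr (sqrtrM _ (ltW a0)) mulKf ?gt_eqF ?sqrtr_gt0.
  - by rewrite invr_gt0 sqrtr_gt0.
  - by rewrite gt_eqF// sqrtr_gt0 subr_gt0.
- by apply: filterS cW => w; exact: within_continuous_dilate.
Qed.

(** The substitution u = a v in the inner integral produces
    a * a^(H - 3/2) * a^(H - 1/2); with the factor a^(1/2 - H) coming from
    s^(1/2 - H) this leaves a^(H - 1/2), as in the first summand of the
    kernel. *)
Lemma volterra_kernel_homogeneous {R : realType} (H a t s : R) : 0 < a ->
  volterra_kernel H (a * t) (a * s) = a `^ (H - 1 / 2) * volterra_kernel H t s.
Proof.
move=> a0; rewrite /volterra_kernel ltr_pM2l// pmulr_rgt0//.
case: (boolP (0 < s < t)) => [/andP[s0 st]|_]; last by rewrite mulr0.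
have t0 : 0 < t := lt_trans s0 st.
pose g u := u `^ (H - 3 / 2) * (u - s) `^ (H - 1 / 2).
pose J := \int[lebesgue_measure]_(u in `]s, t[) g u.
have -> : \int[lebesgue_measure]_(u in `]a * s, a * t[)
      (u `^ (H - 3 / 2) * (u - a * s) `^ (H - 1 / 2)) =
    a * (a `^ (H - 3 / 2) * a `^ (H - 1 / 2) * J).
  rewrite (@Rintegral_dilation _ a)// set_itv_dilation//= !mulKf ?gt_eqF//.
  congr (_ * _); rewrite -gt0_RintegralZl ?mulr_gt0 ?powR_gt0//.
  apply: eq_Rintegral => u.
  rewrite inE/= in_itv/= => /andP[su ut].
  rewrite -mulrBr !powRM ?subr_ge0 ?(ltW su) ?(ltW a0) ?(ltW (lt_trans s0 su))//.
  by rewrite mulrACA.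
have -> : \int[lebesgue_measure]_(u in `]s, t[)
      (u `^ (H - 3 / 2) * (u - s) `^ (H - 1 / 2)) = J by [].
have -> : a * t / (a * s) = t / s.
  by rewrite -mulf_div divff ?mul1r// gt_eqF.
have ts0 : 0 <= t - s by rewrite subr_ge0 ltW.
rewrite -mulrBr (@powRM _ a (t - s) _ (ltW a0) ts0).
rewrite (@powRM _ a s _ (ltW a0) (ltW s0)).
have a1 : a `^ (1 / 2 - H) * (a * a `^ (H - 3 / 2)) = 1.
  rewrite -{2}[a]powRr1 ?(ltW a0)// -!powRD ?(gt_eqF a0) ?implybT//.
  by rewrite (_ : _ + _ = 0) ?powRr0//; lra.
set A := a `^ (1 / 2 - H) in a1 *; set B := a `^ (H - 3 / 2) in a1 *.
rewrite (_ : (H - 1 / 2) * (A * _) * _ = A * (a * B) * (a `^ (H - 1 / 2) *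
     ((H - 1 / 2) * s `^ (1 / 2 - H) * J))); last by ring.
by rewrite a1 mul1r; ring.
Qed.

(** If step functions q_n approximate f, then the step functions c q_n (a .)
    approximate c f (a .); they have their jumps at times divided by a, where
    the increments of the dilated integrator are b times those of W at the
    original times.  Both mean square errors get multiplied by constants. *)
Lemma wiener_integral_dilate {R : realType} d (T : measurableType d)
    (P : probability T R) (b c a : R) (W : R -> T -> R) (f : R -> R)
    (Y : T -> R) : 0 < a -> 0 < b -> 0 < c ->
  wiener_integral P W f Y ->
  wiener_integral P (dilate b a W) (fun s => c * f (a * s))
    (fun w => b * c * Y w).
Proof.
move=> a0 b0 c0 [q [q0 qf qY]].
(* the step on ]u, v] of q_n becomes a step of q_n (a .) on ]u / a, v / a] *)
pose r p : R * (R * R) := (c * p.1, (a^-1 * p.2.1, a^-1 * p.2.2)).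
exists (fun n => map r (q n)); split.
- move=> n; rewrite all_map; apply: sub_all (q0 n) => p /= /andP[p1 p2].
  by rewrite mulr_ge0 ?invr_ge0 ?(ltW a0)//= ler_pM2l ?invr_gt0.
- have sr n s : step_fun (map r (q n)) s = c * step_fun (q n) (a * s).
    rewrite /step_fun big_map mulr_sumr; apply: eq_bigr => p _ /=.
    by rewrite ltr_pdivrMl// ler_pdivlMl// mulrA.
  have -> : (fun n => \int[lebesgue_measure]_(s in `[0%R, +oo[)
      ((step_fun (map r (q n)) s - c * f (a * s)) ^+ 2)%:E)%E =
    (fun n => (c ^+ 2 / a)%:E * \int[lebesgue_measure]_(s in `[0%R, +oo[)
      ((step_fun (q n) s - f s) ^+ 2)%:E)%E.
    apply/funext => n; rewrite EFinM -muleA.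
    rewrite -(@integral_dilation _ a _ (fun s => ((step_fun (q n) s - f s) ^+ 2)%:E))//.
    rewrite set_itv_dilation//= mulr0 -gt0_integralZl ?exprn_gt0//.
    by apply: eq_integral => s _; rewrite sr -mulrBr exprMn EFinM.
  by rewrite -(mule0 (c ^+ 2 / a)%:E); exact: cvgeZl.
- have ir n w : step_integral (dilate b a W) (map r (q n)) w =
      b * c * step_integral W (q n) w.
    rewrite /step_integral big_map mulr_sumr; apply: eq_bigr => p _ /=.
    rewrite /dilate !mulVKf ?gt_eqF//; ring.
  have -> : (fun n => \int[P]_w
      ((step_integral (dilate b a W) (map r (q n)) w - b * c * Y w) ^+ 2)%:E)%E =
    (fun n => ((b * c) ^+ 2)%:E * \int[P]_w
      ((step_integral W (q n) w - Y w) ^+ 2)%:E)%E.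
    apply/funext => n; rewrite -gt0_integralZl ?exprn_gt0 ?mulr_gt0//.
    by apply: eq_integral => w _; rewrite ir -mulrBr exprMn EFinM.
  by rewrite -(mule0 ((b * c) ^+ 2)%:E); exact: cvgeZl.
Qed.

(** * Fractional Brownian motion *)

Lemma expectation_gt0Zl {R : realType} d (T : measurableType d)
    (P : probability T R) (c : R) (X : T -> R) : 0 < c ->
  expectation P (fun w => c * X w) = (c%:E * expectation P X)%E.
Proof.
by move=> c0; rewrite unlock -gt0_integralZl.
Qed.

Lemma covariance_gt0Zlr {R : realType} d (T : measurableType d)
    (P : probability T R) (c : R) (X Y : T -> R) : 0 < c ->
  covariance P (fun w => c * X w) (fun w => c * Y w) =
  ((c ^+ 2)%:E * covariance P X Y)%E.
Proof.
move=> c0; rewrite !covariance.unlock -expectation_gt0Zl ?exprn_gt0//.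
congr expectation; apply/funext => w.
rewrite !expectation_gt0Zl// !fine_gt0Zl//=.
change ((c * X w - c * fine (expectation P X)) *
        (c * Y w - c * fine (expectation P Y)) =
        c ^+ 2 * ((X w - fine (expectation P X)) *
                  (Y w - fine (expectation P Y)))).
ring.
Qed.

Lemma fbm_dilate {R : realType} d (T : measurableType d)
    (P : probability T R) (H a : R) (B : R -> T -> R) : 0 < a ->
  fbm P H B -> fbm P H (dilate (a `^ (- H)) a B).
Proof.
move=> a0 [H01 cB gB eB vB].
have aH0 : 0 < a `^ (- H) by rewrite powR_gt0.
have at0 t : 0 <= t -> 0 <= a * t by move=> t0; rewrite mulr_ge0// ltW.
split=> //.
- exact: cadlag_process_dilate.
- move=> n t c t0.
  rewrite (_ : (fun w => _) =
    fun w => \sum_(i < n) (c i * a `^ (- H)) * B (a * t i) w).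
    by apply: (gB n (fun i => a * t i)) => i; exact: at0.
  by apply/funext => w; apply: eq_bigr => i _; rewrite /dilate mulrA.
- by move=> t t0; rewrite /dilate expectation_gt0Zl// eB ?mule0//; exact: at0.
- move=> s t s0 t0; rewrite /dilate covariance_gt0Zlr// vB ?at0// -EFinM.
  congr EFin; rewrite -mulrBr normrM (gtr0_norm a0) !powRM ?(ltW a0)//.
  have -> : (a `^ (- H)) ^+ 2 = (a `^ (2 * H))^-1.
    by rewrite -powR_mulrn ?powR_ge0// -powRrM -powRN mulrC mulrN.
  have := powR_gt0 (2 * H) a0; move: (a `^ (2 * H)) => u u0.
  by field; rewrite gt_eqF.
Qed.

(** The Brownian motion W'(t) = a^(-1/2) W(a t) represents the dilated process:
    by homogeneity K_H(t, s) = a^(1/2 - H) K_H(a t, a s), and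
    a^(-1/2) a^(1/2 - H) = a^(-H). *)
Lemma fbm_wrt_dilate {R : realType} d (T : measurableType d)
    (P : probability T R) (F : R -> set (set T)) (H a : R) (B : R -> T -> R) :
  0 < a -> fbm_wrt P F H B ->
  fbm_wrt P (fun t => F (a * t)) H (dilate (a `^ (- H)) a B).
Proof.
move=> a0 [fB aB [W [bW wB]]]; split.
- exact: fbm_dilate.
- exact: adapted_dilate.
exists (dilate (Num.sqrt a)^-1 a W); split; first exact: brownian_wrt_dilate.
move=> t t0.
have sa0 : 0 < (Num.sqrt a)^-1 by rewrite invr_gt0 sqrtr_gt0.
have c0 : 0 < a `^ (1 / 2 - H) by rewrite powR_gt0.
have at0 : 0 <= a * t by rewrite mulr_ge0// ltW.
have := wiener_integral_dilate a0 sa0 c0 (wB (a * t) at0).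
rewrite (_ : (fun s => _) = volterra_kernel H t).
  rewrite (_ : (fun w => _) = dilate (a `^ (- H)) a B t)//.
  apply/funext => w; rewrite /dilate; congr (_ * _).
  rewrite powRD ?(gt_eqF a0) ?implybT// mul1r powR12_sqrt ?(ltW a0)//.
  by rewrite mulKf// gt_eqF// sqrtr_gt0.
apply/funext => s; rewrite volterra_kernel_homogeneous// mulrA -powRD.
  by rewrite (_ : _ + _ = 0) ?powRr0 ?mul1r//; lra.
by rewrite (gt_eqF a0) implybT.
Qed.

Lemma second_moment_law {R : realType} d (T : measurableType d)
    (P : probability T R) (X Y : T -> R) :
  measurable_fun setT X -> measurable_fun setT Y ->
  (forall C : set R, measurable C -> P (X @^-1` C) = P (Y @^-1` C)) ->
  (\int[P]_w (X w ^+ 2)%:E = \int[P]_w (Y w ^+ 2)%:E)%E.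
Proof.
move=> mX mY XY.
pose X' : {mfun T >-> R} := HB.pack X (isMeasurableFun.Build _ _ _ _ _ mX).
pose Y' : {mfun T >-> R} := HB.pack Y (isMeasurableFun.Build _ _ _ _ _ mY).
have msq : measurable_fun setT (fun x : R => (x ^+ 2)%:E).
  by apply/measurable_EFinP; exact: measurable_funX.
have sq0 (x : R) : (0 <= (x ^+ 2)%:E)%E by rewrite lee_fin sqr_ge0.
have lawE (Z : {mfun T >-> R}) : (\int[P]_w (Z w ^+ 2)%:E =
    \int[distribution P Z]_x (x ^+ 2)%:E)%E.
  by rewrite ge0_integral_distribution.
rewrite (lawE X') (lawE Y').
by apply: eq_measure_integral => A mA _; exact: XY.
Qed.

(** The variance of B(2) is 2^(2H) for a fractional Brownian motion and
    2^(2 beta) times the variance of B(1), which is 1, by self-similarity. *)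
Lemma self_similar_fbm_index {R : realType} d (T : measurableType d)
    (P : probability T R) (H beta : R) (B : R -> T -> R) :
  self_similar P beta B -> fbm P H B -> H = beta.
Proof.
move=> ssB [/andP[H0 _] [mB _] _ eB vB].
have variance t : 0 <= t ->
    (\int[P]_w (B t w ^+ 2)%:E = (t `^ (2 * H))%:E)%E.
  move=> t0; have := vB t t t0 t0.
  rewrite covariance.unlock eB//= expectation.unlock subrr normr0.
  rewrite powR0 ?mulf_neq0 ?gt_eqF//.
  rewrite (_ : 2^-1 * _ = t `^ (2 * H)); last by field.
  move=> <-; apply: eq_integral => w _; congr EFin.
  change (B t w ^+ 2 = (B t w - 0) * (B t w - 0)).
  by rewrite subr0 expr2.
have b0 : 0 < 2 `^ beta :> R by rewrite powR_gt0.
have : (\int[P]_w (B 2 w ^+ 2)%:E =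
    \int[P]_w ((2 `^ beta * B 1 w) ^+ 2)%:E)%E.
  apply: second_moment_law => [||C mC].
  - exact: mB.
  - by apply: measurable_funM => //; exact: mB.
  - have := ssB 2 (ltr0Sn _ 1) [set f | C (f 1)].
    rewrite /= mulr1; apply; apply: sub_sigma_algebra.
    by exists 1, C.
under [X in _ = X]eq_integral do rewrite exprMn EFinM.
rewrite gt0_integralZl ?exprn_gt0// !variance// powR1 mule1 => -[].
rewrite mulrC powRrM powR_mulrn ?powR_ge0// => /eqP.
rewrite eqrXn2 ?powR_ge0// => /eqP /(congr1 (@ln R)).
rewrite !ln_powR => /mulIf; apply; rewrite gt_eqF// ln_gt0//.
by rewrite ltr1n.
Qed.

(** * The rescaled equation *)

(** Homogeneity also holds at y = 0 with alpha < 0, where abs_pow is infinite: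
    a positive factor does not change an infinite value. *)
Lemma drift_scale {R : realType} (cp cm alpha r y : R) : 0 < r ->
  drift cp cm alpha (r * y) = ((r `^ alpha)%:E * drift cp cm alpha y)%E.
Proof.
move=> r0; rewrite /drift pmulr_rge0// pmulr_rlt0// muleCA; congr (_ * _)%E.
rewrite /abs_pow mulf_eq0 gt_eqF//=; case: ifPn => _.
  by rewrite gt0_muley// lte_fin powR_gt0.
by rewrite normrM (gtr0_norm r0) powRM// ltW.
Qed.

Lemma drift_coef_scale {R : realType} (cp cm alpha k y : R) :
  drift (cp * k) (cm * k) alpha y = (k%:E * drift cp cm alpha y)%E.
Proof.
rewrite /drift muleA -EFinM; congr (_%:E * _)%E; ring.
Qed.

Lemma drift_integrable_dilate {R : realType} (cp cm alpha r a t : R)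
    (f : R -> R) : 0 < r -> 0 < a ->
  drift_integrable cp cm alpha f (a * t) ->
  drift_integrable cp cm alpha (fun s => r * f (a * s)) t.
Proof.
move=> r0 a0 /integrableP[mf intf].
have ra0 : 0 < r `^ alpha by rewrite powR_gt0.
have itvE : [set x | `[0, a * t]%classic (a * x)] = `[0, t]%classic.
  by rewrite set_itv_dilation//= mulr0 mulKf// gt_eqF.
apply/integrableP; split.
  rewrite (_ : (fun s => _) = fun s =>
    ((r `^ alpha)%:E * drift cp cm alpha (f (a * s)%R))%E); last first.
    by apply/funext => s; rewrite drift_scale.
  apply: measurable_funeM.
  have ma : measurable_fun `[0, t]%classic
      ( *%R a : measurableTypeR R -> measurableTypeR R).
    exact: mulrl_measurable.
  apply: (measurable_comp (F := `[0, a * t]%classic) _ _ mf ma) => //.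
  move=> _ [s /= st <-]; move: st; rewrite !in_itv/= => /andP[s0 st].
  by rewrite mulr_ge0 ?(ltW a0)//= ler_pM2l.
rewrite -itvE.
under eq_integral do rewrite drift_scale// abseM gee0_abs ?lee_fin ?powR_ge0//.
rewrite gt0_integralZl//.
rewrite (@integral_dilation _ a _ (fun s => `|drift cp cm alpha (f s)|%E))//.
rewrite muleA -EFinM.
have c0 : 0 < r `^ alpha * a^-1 by rewrite mulr_gt0// invr_gt0.
by rewrite lte_mul_pinfty// lee_fin ltW.
Qed.

Lemma drift_integral_dilate {R : realType} (cp cm alpha r a t : R)
    (f : R -> R) : 0 < r -> 0 < a ->
  drift_integral cp cm alpha (fun s => r * f (a * s)) t =
  r `^ alpha / a * drift_integral cp cm alpha f (a * t).
Proof.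
move=> r0 a0; rewrite /drift_integral.
have itvE : [set x | `[0, a * t]%classic (a * x)] = `[0, t]%classic.
  by rewrite set_itv_dilation//= mulr0 mulKf// gt_eqF.
rewrite -itvE.
under eq_integral do rewrite drift_scale//.
rewrite gt0_integralZl ?powR_gt0//.
rewrite (@integral_dilation _ a _ (fun s => drift cp cm alpha (f s)))//.
by rewrite !fine_gt0Zl ?invr_gt0 ?powR_gt0// mulrA.
Qed.

(** The drift integral up to time a t of f is a r^(-alpha) times that of r f(a .)
    up to time t; the additional factor r comes from scaling the equation. *)
Lemma scaled_sde_dilate {R : realType} (x k cp cm alpha eps beta r a : R)
    (f b : R -> R) : 0 < r -> 0 < a ->
  scaled_sde x k cp cm alpha eps f b ->
  scaled_sde (r * x) (r `^ (1 - alpha) * a * k) cp cm alpha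
    (r * a `^ beta * eps)
    (fun t => r * f (a * t)) (fun t => a `^ (- beta) * b (a * t)).
Proof.
move=> r0 a0 eq_f t t0.
have at0 : 0 <= a * t by rewrite mulr_ge0// ltW.
have [int_f ->] := eq_f _ at0; split; first exact: drift_integrable_dilate.
rewrite drift_integral_dilate// powRN !mulrDr.
have ab0 : a `^ beta != 0 by rewrite gt_eqF// powR_gt0.
have rr : r `^ (1 - alpha) * r `^ alpha = r.
  by rewrite -powRD ?(gt_eqF r0) ?implybT// subrK powRr1// ltW.
congr (_ + _ + _).
  rewrite -[in LHS]rr; field; exact: lt0r_neq0.
by field.
Qed.

Lemma scaled_sde1 {R : realType} (x cp cm alpha eps : R) :
  scaled_sde x 1 cp cm alpha eps = sde x cp cm alpha eps.
Proof.
by apply/funext => f; apply/funext => b; rewrite /scaled_sde /sde;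
  under eq_forall do rewrite mul1r.
Qed.

Lemma scaled_sdeE {R : realType} (x k cp cm alpha eps : R) : 0 < k ->
  scaled_sde x k cp cm alpha eps = sde x (cp * k) (cm * k) alpha eps.
Proof.
move=> k0; apply/funext => f; apply/funext => b; rewrite /scaled_sde /sde.
have driftE : (fun s => drift (cp * k) (cm * k) alpha (f s)) =
    (fun s => k%:E * drift cp cm alpha (f s))%E.
  by apply/funext => s; rewrite drift_coef_scale.
have integrableE t : drift_integrable (cp * k) (cm * k) alpha f t =
    drift_integrable cp cm alpha f t.
  rewrite /drift_integrable driftE; apply/propext; split => h.
    rewrite (_ : (fun s => drift _ _ _ _) = (fun s =>
      k^-1%:E * (k%:E * drift cp cm alpha (f s)))%E).
      exact: integrableZl.
    by apply/funext => s; rewrite muleA -EFinM mulVf ?gt_eqF// mul1e.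
  exact: integrableZl.
have integralE t : drift_integral (cp * k) (cm * k) alpha f t =
    k * drift_integral cp cm alpha f t.
  rewrite /drift_integral -fine_gt0Zl// -gt0_integralZl//.
  by congr fine; apply: eq_integral => s _; exact: drift_coef_scale.
by apply/propext; split=> h t /h; rewrite integrableE integralE.
Qed.

(** Every clause of a weak solution is stable under the dilation, separately.
    For a fractional Brownian noise, the factor a^(-beta) of self-similarity has
    to be identified with the factor a^(-H) that preserves the covariance. *)
Lemma weak_solution_dilate {R : realType} d0 (T0 : measurableType d0)
    (P0 : probability T0 R) (B0 : R -> T0 -> R)
    (beta x k cp cm alpha eps r a : R)
    d (T : measurableType d) (P : probability T R)
    (F : R -> set (set T)) (X B : R -> T -> R) :
  self_similar P0 beta B0 -> 0 < r -> 0 < a ->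
  weak_solution P0 B0 (scaled_sde x k cp cm alpha eps) P F X B ->
  weak_solution P0 B0
    (scaled_sde (r * x) (r `^ (1 - alpha) * a * k) cp cm alpha
      (r * a `^ beta * eps))
    P (fun t => F (a * t)) (dilate r a X) (dilate (a `^ (- beta)) a B).
Proof.
move=> ssB r0 a0 [[fF [cX cB]] [aX aB] eq_X lawB [levyB fbmB]]; split.
- split; first exact: filtration_dilate.
  by split; exact: cadlag_process_dilate.
- by split; exact: adapted_dilate.
- by apply: filterS eq_X => w; exact: scaled_sde_dilate.
- apply: same_distribution_trans (self_similar_dilate a0 ssB).
  by apply: same_distribution_dilate => //; exact: ltW.
- split=> [/levyB|H fB]; first exact: levy_wrt_dilate.
  rewrite -(self_similar_fbm_index ssB fB).
  by apply: fbm_wrt_dilate => //; exact: fbmB.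
Qed.

Theorem lemma2p1 (R : realType) (d0 : measure_display)
    (T0 : measurableType d0) (P0 : probability T0 R) (Bbeta : R -> T0 -> R)
    (beta cp cm alpha x eps delta gamma : R)
    (beta_gt0 : 0 < beta)
    (Bbeta_cadlag : cadlag_process Bbeta)
    (Bbeta_self_similar : self_similar P0 beta Bbeta)
    (cp_gt0 : 0 < cp) (cm_gt0 : 0 < cm)
    (alpha_itv : -1 < alpha < 1) (eps_gt0 : 0 < eps) :
  let k := eps `^ (delta * (1 - alpha) - gamma) in
  let eps' := eps `^ (1 + delta - gamma * beta) in
  let eqA := sde x cp cm alpha eps in
  let eqB := scaled_sde (x * eps `^ delta) k cp cm alpha eps' in
  [/\ (forall (d : measure_display) (T : measurableType d)
         (P : probability T R) (F : R -> set (set T)) (X B : R -> T -> R),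
       weak_solution P0 Bbeta eqA P F X B ->
       exists (F' : R -> set (set T)) (B' : R -> T -> R),
         weak_solution P0 Bbeta eqB P F' (rescale eps delta gamma X) B'),
      (weak_uniqueness P0 Bbeta eqA \/ weak_uniqueness P0 Bbeta eqB ->
       forall (d : measure_display) (T : measurableType d)
         (P : probability T R) (F : R -> set (set T)) (X B : R -> T -> R)
         (d' : measure_display) (T' : measurableType d')
         (P' : probability T' R) (F' : R -> set (set T')) (Y B' : R -> T' -> R),
       weak_solution P0 Bbeta eqA P F X B ->
       weak_solution P0 Bbeta
         (sde (x * eps `^ delta) (cp * k) (cm * k) alpha eps') P' F' Y B' ->
       same_distribution P (rescale eps delta gamma X) P' Y) &
      (x = 0 -> (1 - alpha) * beta != 1 ->
       delta = 1 / ((1 - alpha) * beta - 1) ->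
       gamma = (1 - alpha) / ((1 - alpha) * beta - 1) ->
       forall (d : measure_display) (T : measurableType d)
         (P : probability T R) (F : R -> set (set T)) (X B : R -> T -> R),
       weak_solution P0 Bbeta eqA P F X B ->
       exists (F' : R -> set (set T)) (B' : R -> T -> R),
         weak_solution P0 Bbeta (sde 0 cp cm alpha 1) P F'
           (rescale eps delta gamma X) B')].
Proof.
move=> k eps' eqA eqB.
pose r := eps `^ delta; pose a := eps `^ (- gamma).
have r0 : 0 < r by rewrite powR_gt0.
have a0 : 0 < a by rewrite powR_gt0.
have k0 : 0 < k by rewrite powR_gt0.
have epsD u v : eps `^ u * eps `^ v = eps `^ (u + v).
  by rewrite powRD ?(gt_eqF eps_gt0) ?implybT.
have kE : r `^ (1 - alpha) * a = k by rewrite -powRrM epsD.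
have eps'E : r * a `^ beta * eps = eps'.
  rewrite -powRrM -{2}[eps]powRr1 ?(ltW eps_gt0)// !epsD; congr powR; ring.
have forward d (T : measurableType d) (P : probability T R) F X B :
    weak_solution P0 Bbeta eqA P F X B ->
    weak_solution P0 Bbeta eqB P (fun t => F (a * t))
      (rescale eps delta gamma X) (dilate (a `^ (- beta)) a B).
  rewrite /eqA -scaled_sde1 => solX.
  have := weak_solution_dilate Bbeta_self_similar r0 a0 solX.
  by rewrite mulr1 kE eps'E mulrC.
have backward d (T : measurableType d) (P : probability T R) F Y B :
    weak_solution P0 Bbeta eqB P F Y B ->
    exists F' B', weak_solution P0 Bbeta eqA P F' (dilate r^-1 a^-1 Y) B'.
  have r'0 : 0 < r^-1 by rewrite invr_gt0.
  have a'0 : 0 < a^-1 by rewrite invr_gt0.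
  move=> solY.
  have := weak_solution_dilate Bbeta_self_similar r'0 a'0 solY.
  rewrite mulrC mulfK ?gt_eqF//.
  have powRV u v : 0 < u -> u^-1 `^ v = (u `^ v)^-1.
    by move=> u0; rewrite -(powR_inv1 (ltW u0)) powRAC powR_inv1 ?powR_ge0.
  have rV0 : r `^ (1 - alpha) != 0 by rewrite gt_eqF// powR_gt0.
  have aV0 : a `^ beta != 0 by rewrite gt_eqF// powR_gt0.
  rewrite (_ : _ * k = 1); last first.
    by rewrite -kE powRV//; field; rewrite rV0 gt_eqF.
  rewrite (_ : _ * eps' = eps); last first.
    by rewrite -eps'E powRV//; field; rewrite aV0 gt_eqF.
  rewrite scaled_sde1 => solY'.
  by exists (fun t => F (a^-1 * t)); eexists; exact: solY'.
split.
- by move=> d T P F X B /forward; eexists; eexists; eassumption.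
- move=> uniq d T P F X B d' T' P' F' Y B' solX.
  rewrite -scaled_sdeE// => solY; case: uniq => [uniqA|uniqB].
    (* scale Y back to a solution of (A), compare with X, then rescale both *)
    have [G [C solY']] := backward _ _ _ _ _ _ solY.
    have := same_distribution_dilate r (ltW a0)
      (uniqA _ _ _ _ _ _ _ _ _ _ _ _ solX solY').
    by rewrite dilateK// gt_eqF.
  exact: uniqB _ _ _ _ _ _ _ _ _ _ _ _ (forward _ _ _ _ _ _ solX) solY.
- move=> x0 ne1 deltaE gammaE d T P F X B /forward solX.
  have den0 : (1 - alpha) * beta - 1 != 0 by rewrite subr_eq0.
  exists (fun t => F (a * t)), (dilate (a `^ (- beta)) a B).
  have k1 : k = 1.
    rewrite /k (_ : _ - _ = 0) ?powRr0// deltaE gammaE; field.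
    exact: den0.
  have eps'1 : eps' = 1.
    rewrite /eps' (_ : _ - _ = 0) ?powRr0// deltaE gammaE; field.
    exact: den0.
  by move: solX; rewrite /eqB x0 mul0r k1 eps'1 scaled_sde1.
Qed.
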